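(* Let $S$ be a finite monoid that is a right regular band of groups and let $k$ be an algebraically closed field whose characteristic does not divide the order of any maximal subgroup of $S$. Let $J$ be the minimal ideal of $S$ and $G$ the group of units of $S$, and assume $G\neq J$. Let $e\in J$ be an idempotent and $H=eJe$ the maximal subgroup at $e$. Let $U$ be a simple right $kH$-module and $V$ a simple right $kG$-module, let $\widetilde U$ be the simple $kS$-module with apex $J$ corresponding to $U$, and let $\widetilde V$ be the simple $kS$-module with apex $G$ corresponding to $V$. Let $M$ be the $kH$-$kG$-bimodule defined in the context. Then $\dim_k \mathrm{Ext}^1_{kS}(\widetilde U,\widetilde V)$ is the multiplicity of $V$ as a composition factor of the right $kG$-module $U\otimes_{kH}M$.
   Context: Modules are finitely generated right modules unless stated otherwise. A right regular band of groups is a (finite) regular semigroup (for all $s$ there is $t$ with $sts=s$) in which every right ideal is two-sided. The maximal subgroup at an idempotent $e$ is the group of units of $eSe$. In the present setting $J=eS$ and $Se=H$. Simple modules: $\widetilde U$ is $U$ with $S$ acting by $u\cdot s=u(se)$ (note $se\in Se=H$). $\widetilde V$ is $V$ with $G$ acting as given and every element of $S\setminus G$ acting as $0$. The bimodule $M$: let $I=S\setminus G$, an ideal of $S$. Define a relation $\smile$ on $J$ by $x\smile x'$ iff (1) $xe=x'e$ and (2) there exists $w\in I\setminus J$ with $xw=x$ and $x'w=x'$. Let $\approx$ be the equivalence relation on $J$ generated by $\smile$, and let $X=J/{\approx}$, with $[x]$ the class of $x$. Left multiplication by $H$ and right multiplication by $G$ on $J$ induce commuting actions on $X$, so $kX$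 is a $kH$-$kG$-bimodule. View $kH$ as a $kH$-$kG$-bimodule with left multiplication by $H$ and right action of $g\in G$ by right multiplication by $ge\in H$ (the map $g\mapsto ge$ is a group homomorphism $G\to H$). The map $\epsilon\colon kX\to kH$, $[x]\mapsto xe$, is a surjective bimodule homomorphism, and $M=\ker\epsilon$. *)

(* Defs.v *)
From HB Require Import structures.
From mathcomp Require Import all_boot.

(* This structure has to precede the loading of fingroup, whose finStarMonoidType
   HB otherwise takes for the join of monoidType and finType. *)
#[short(type="finMonoidType")]
HB.structure Definition FinMonoid := {S of Monoid S & Finite S}.

From mathcomp Require Import all_order all_algebra all_fingroup.
From mathcomp Require Import mxrepresentation boolp.

Set Implicit Arguments.
Unset Strict Implicit.
Unset Printing Implicit Defensive.

Import GRing.Theory.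
Local Open Scope group_scope.

Definition right_ideal (S : finMonoidType) (A : {set S}) : Prop :=
  forall a s, a \in A -> a * s \in A.

Definition left_ideal (S : finMonoidType) (A : {set S}) : Prop :=
  forall a s, a \in A -> s * a \in A.

Definition ideal (S : finMonoidType) (A : {set S}) : Prop :=
  left_ideal A /\ right_ideal A.

Definition minimal_ideal (S : finMonoidType) (J : {set S}) : Prop :=
  [/\ ideal J, J != set0 &
      forall A : {set S}, ideal A -> A != set0 -> A \subset J -> A = J].

Definition regular_semigroup (S : finMonoidType) : Prop :=
  forall s : S, exists t, s * t * s = s.

Definition right_regular_band_of_groups (S : finMonoidType) : Prop :=
  regular_semigroup S /\ forall A : {set S}, right_ideal A -> ideal A.

Record idempotent_of (S : finMonoidType) :=
  Idempotent { idem_val :> S; idemM : idem_val * idem_val = idem_val }.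

Definition idem1 (S : finMonoidType) : idempotent_of S :=
  Idempotent (mul1g (1 : S)).

Section MaximalSubgroup.
Variables (S : finMonoidType) (e0 : idempotent_of S).
Local Notation e := (idem_val e0).

Definition local_monoid : {set S} := [set x : S | e * x * e == x].

Lemma local_monoidP (x : S) :
  reflect (e * x = x /\ x * e = x) (x \in local_monoid).
Proof.
rewrite inE; apply: (iffP eqP) => [<-|[ex xe]]; last by rewrite ex xe.
by rewrite !mulgA idemM -!mulgA idemM.
Qed.

(* The group of units of the local monoid eSe; for e = 1 this is the group
   of units of S. *)
Definition max_subgroup_set : {set S} :=
  [set x in local_monoid |
     [exists y in local_monoid, (x * y == e) && (y * x == e)]].

Definition max_subgroup : Type := {x : S | x \in max_subgroup_set}.
HB.instance Definition _ := Finite.on max_subgroup.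

Lemma max_subgroup_setP (x : S) :
  reflect [/\ e * x = x, x * e = x &
     exists y, [/\ e * y = y, y * e = y, x * y = e & y * x = e]]
    (x \in max_subgroup_set).
Proof.
rewrite inE; apply: (iffP andP).
  case=> /local_monoidP[ex xe] /existsP[y /and3P[/local_monoidP[ey ye]]].
  by move=> /eqP xy /eqP yx; split=> //; exists y.
case=> ex xe [y [ey ye xy yx]]; split; first exact/local_monoidP.
apply/existsP; exists y; rewrite xy yx !eqxx.
by apply/andP; split; first exact/local_monoidP.
Qed.

Lemma max_subgroup_mul_subproof (x y : max_subgroup) :
  val x * val y \in max_subgroup_set.
Proof.
have [/= ex xe [x' [ex' xe' xx' x'x]]] := max_subgroup_setP _ (valP x).
have [/= ey ye [y' [ey' ye' yy' y'y]]] := max_subgroup_setP _ (valP y).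
apply/max_subgroup_setP; split; first by rewrite mulgA ex.
  by rewrite -mulgA ye.
exists (y' * x'); split; first by rewrite mulgA ey'.
- by rewrite -mulgA xe'.
- by rewrite -mulgA (mulgA _ y') yy' ex' xx'.
- by rewrite -mulgA (mulgA x') x'x ey y'y.
Qed.

Lemma max_subgroup_one_subproof : e \in max_subgroup_set.
Proof.
by apply/max_subgroup_setP; rewrite !idemM; split=> //; exists e; rewrite !idemM.
Qed.

Lemma max_subgroup_inv_subproof (x : max_subgroup) :
  {y : max_subgroup | val y * val x == e}.
Proof.
apply: sigW; have [/= ex xe [y [ey ye xy yx]]] := max_subgroup_setP _ (valP x).
have ymem : y \in max_subgroup_set.
  by apply/max_subgroup_setP; split=> //; exists (val x).
by exists (Sub y ymem); rewrite SubK yx.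
Qed.

Definition max_subgroup_mul (x y : max_subgroup) : max_subgroup :=
  Sub (val x * val y) (max_subgroup_mul_subproof x y).
Definition max_subgroup_one : max_subgroup := Sub e max_subgroup_one_subproof.
Definition max_subgroup_inv (x : max_subgroup) : max_subgroup :=
  sval (max_subgroup_inv_subproof x).

Lemma max_subgroup_mulA : associative max_subgroup_mul.
Proof. by move=> x y z; apply: val_inj; rewrite !SubK mulgA. Qed.
Lemma max_subgroup_mul1 : left_id max_subgroup_one max_subgroup_mul.
Proof.
move=> x; apply: val_inj; rewrite !SubK.
by case/max_subgroup_setP: (valP x).
Qed.
Lemma max_subgroup_mulV :
  left_inverse max_subgroup_one max_subgroup_inv max_subgroup_mul.
Proof.
move=> x; apply: val_inj; rewrite !SubK.
exact/eqP/(svalP (max_subgroup_inv_subproof x)).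
Qed.

HB.instance Definition _ := Finite_isGroup.Build max_subgroup
  max_subgroup_mulA max_subgroup_mul1 max_subgroup_mulV.

End MaximalSubgroup.

Notation units_set S := (max_subgroup_set (idem1 S)).
Notation units_group S := (max_subgroup (idem1 S)).

(* A finitely generated right kS-module is a finite-dimensional space with a
   linear right action of S, here 'rV_n with s acting by v |-> v *m r s. This is
   the convention of mx_representation, used below for the modules over kG and
   kH. *)

Section MonoidRepresentation.
Variables (k : fieldType) (S : finMonoidType).
Local Open Scope ring_scope.

Definition monoid_mx_repr n (r : S -> 'M[k]_n) : Prop :=
  r 1%g = 1%:M /\ {morph r : s t / (s * t)%g >-> s *m t}.

Structure monoid_representation n := MonoidRepresentation {
  monoid_repr_mx :> S -> 'M[k]_n;
  monoid_repr_mxP : monoid_mx_repr monoid_repr_mx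
}.

Definition hom_mx m n (rU : monoid_representation m)
    (rV : monoid_representation n) (f : 'M[k]_(m, n)) : Prop :=
  forall s, rU s *m f = f *m rV s.

Definition projective p (rP : monoid_representation p) : Prop :=
  forall m n (rY : monoid_representation m) (rZ : monoid_representation n)
    (q : 'M_(m, n)) (f : 'M_(p, n)),
  hom_mx rY rZ q -> row_full q -> hom_mx rP rZ f ->
  exists2 g : 'M_(p, m), hom_mx rP rY g & g *m q = f.

Structure projective_resolution n (rU : monoid_representation n) :=
  ProjectiveResolution {
    res_dim : nat -> nat;
    res_mod : forall i, monoid_representation (res_dim i);
    res_diff : forall i, 'M[k]_(res_dim i.+1, res_dim i);
    res_aug : 'M[k]_(res_dim 0, n);
    res_projective : forall i, projective (res_mod i);
    res_diff_hom : forall i, hom_mx (res_mod i.+1) (res_mod i) (res_diff i);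
    res_aug_hom : hom_mx (res_mod 0) rU res_aug;
    res_aug_surj : row_full res_aug;
    res_aug_exact : (res_diff 0 :=: kermx res_aug)%MS;
    res_diff_exact : forall i, (res_diff i.+1 :=: kermx (res_diff i))%MS
  }.

Definition Hom_space m n (rU : monoid_representation m)
    (rV : monoid_representation n) : {vspace 'M[k]_(m, n)} :=
  (\bigcap_(s : S) lker (linfun (mulmx (rU s) \- mulmxr (rV s))))%VS.

Lemma Hom_spaceP m n (rU : monoid_representation m)
    (rV : monoid_representation n) f :
  f \in Hom_space rU rV <-> hom_mx rU rV f.
Proof.
rewrite /Hom_space memvE; split=> [/subv_bigcapP Hf s | Hf].
  have := Hf s isT; rewrite -memvE memv_ker lfunE /= => /eqP/subr0_eq.
  by rewrite /=.
apply/subv_bigcapP=> s _; rewrite -memvE memv_ker lfunE /=.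
by rewrite subr_eq0 (Hf s).
Qed.

Section Ext.
Variables (m n : nat) (rU : monoid_representation m).
Variables (P : projective_resolution rU) (rV : monoid_representation n).

Definition cocycles i : {vspace 'M[k]_(res_dim P i, n)} :=
  (Hom_space (res_mod P i) rV :&: lker (linfun (mulmx (res_diff P i))))%VS.

Definition coboundaries i : {vspace 'M[k]_(res_dim P i, n)} :=
  if i is j.+1 then
    (linfun (mulmx (res_diff P j)) @: Hom_space (res_mod P j) rV)%VS
  else 0%VS.

Lemma coboundaries_sub i : (coboundaries i <= cocycles i)%VS.
Proof.
case: i => [|i] /=; first exact: sub0v.
apply/subvP => f /memv_imgP[g /Hom_spaceP Hg ->]; rewrite lfunE /= memv_cap.
apply/andP; split.
  apply/Hom_spaceP => s.
  by rewrite mulmxA res_diff_hom -!mulmxA Hg.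
rewrite memv_ker !lfunE /= mulmxA; apply/eqP.
have -> : res_diff P i.+1 *m res_diff P i = 0.
  by apply/sub_kermxP; rewrite -res_diff_exact.
by rewrite mul0mx.
Qed.

(* The dimension of H^i(Hom_kS(P, V)) = Ext^i_kS(U, V). *)
Definition dim_Ext i : nat := (\dim (cocycles i) - \dim (coboundaries i))%N.

End Ext.
End MonoidRepresentation.

Section FunMx.
Variable k : fieldType.
Local Open Scope ring_scope.

(* The matrix of the linear map kA -> kB induced by f : A -> B. *)
Definition fun_mx (A B : finType) (f : A -> B) : 'M[k]_(#|A|, #|B|) :=
  \matrix_(i, j) (f (enum_val i) == enum_val j)%:R.

Lemma fun_mx_id (A : finType) (f : A -> A) : f =1 id -> fun_mx f = 1%:M.
Proof.
by move=> fE; apply/matrixP=> i j; rewrite !mxE fE (inj_eq enum_val_inj).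
Qed.

Lemma fun_mx_comp (A B C : finType) (f : A -> B) (g : B -> C) (h : A -> C) :
  g \o f =1 h -> fun_mx f *m fun_mx g = fun_mx h.
Proof.
move=> hE; apply/matrixP=> i j; rewrite !mxE -hE.
rewrite (bigD1 (enum_rank (f (enum_val i)))) //= !mxE enum_rankK eqxx mul1r.
rewrite big1 ?addr0 // => l nl; rewrite !mxE.
case: eqP => [fl|]; last by rewrite mul0r.
by case/eqP: nl; rewrite fl enum_valK.
Qed.

End FunMx.

Section ResolutionExists.
Variables (k : fieldType) (S : finMonoidType).
Local Open Scope ring_scope.
Local Notation rep := (monoid_representation k S).

Lemma monoid_repr1 n (r : rep n) : r 1%g = 1%:M.
Proof. by case: (monoid_repr_mxP r). Qed.

Lemma monoid_reprM n (r : rep n) s t : r (s * t)%g = r s *m r t.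
Proof. by case: (monoid_repr_mxP r). Qed.

Section FreeCover.
Variable n : nat.
Local Notation basis := ('I_n * S)%type.

Definition free_mx (s : S) : 'M[k]_#|{: basis}| :=
  fun_mx k (fun b : basis => (b.1, b.2 * s)%g).

Lemma free_mx_repr : monoid_mx_repr free_mx.
Proof.
split=> [|s t]; first by apply: fun_mx_id => -[i u]; rewrite /= mulg1.
by apply/esym/fun_mx_comp => -[i u]; rewrite /= mulgA.
Qed.
Definition free_repr := MonoidRepresentation free_mx_repr.

(* The homomorphism from the free module sending the i-th generator to row i A. *)
Definition free_hom p (r : rep p) (A : 'M[k]_(n, p)) : 'M[k]_(#|{: basis}|, p) :=
  \matrix_b (row (enum_val b).1 A *m r (enum_val b).2).

Lemma row_free_mx s b :
  row b (free_mx s) = delta_mx 0 (enum_rank ((enum_val b).1, (enum_val b).2 * s)%g).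
Proof.
apply/rowP => j; rewrite !mxE eqxx /= -[j in RHS]enum_valK (inj_eq enum_rank_inj).
by rewrite eq_sym.
Qed.

Lemma free_hom_mx p (r : rep p) A : hom_mx free_repr r (free_hom r A).
Proof.
move=> s; apply/row_matrixP => b; rewrite !row_mul row_free_mx -rowE !rowK.
by rewrite enum_rankK /= monoid_reprM mulmxA.
Qed.

Lemma free_homE p (r : rep p) f :
  hom_mx free_repr r f ->
  f = free_hom r (\matrix_i row (enum_rank (i, 1%g)) f).
Proof.
move=> hf; apply/row_matrixP => b; rewrite !rowK -row_mul -hf row_mul row_free_mx.
by rewrite -rowE enum_rankK /= mul1g -surjective_pairing enum_valK.
Qed.

Lemma free_projective : projective free_repr.
Proof.
move=> m p rY rZ q f hq /row_fullP[q' q'q] hf.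
pose A := \matrix_i row (enum_rank (i, 1%g)) f.
exists (free_hom rY (A *m q')); first exact: free_hom_mx.
rewrite [RHS](free_homE hf) -/A; apply/row_matrixP => b.
rewrite row_mul !rowK row_mul -mulmxA hq mulmxA -(mulmxA (row _ A)).
by rewrite q'q mulmx1 rowK.
Qed.

Variable r : rep n.

Definition free_cover : 'M[k]_(#|{: basis}|, n) := free_hom r 1%:M.

Lemma free_cover_full : row_full free_cover.
Proof.
rewrite -sub1mx; apply/row_subP => i.
have -> : row i 1%:M = row (enum_rank (i, 1%g)) free_cover.
  by rewrite rowK enum_rankK /= monoid_repr1 mulmx1.
apply: row_sub.
Qed.

Local Notation K := (kermx free_cover).

Lemma syzygy_stable p (A : 'M_(p, _)) s :
  (val_submod (U := K) A *m free_mx s <= K)%MS.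
Proof.
apply/sub_kermxP; rewrite -mulmxA (free_hom_mx r 1%:M s) mulmxA.
have /sub_kermxP -> := val_submodP (U := K) A.
by rewrite mul0mx.
Qed.

Definition syzygy_mx (s : S) : 'M[k]_(\rank K) :=
  in_submod K (val_submod 1%:M *m free_mx s).

Lemma val_syzygy p (A : 'M_(p, \rank K)) s :
  val_submod (A *m syzygy_mx s) = val_submod A *m free_mx s.
Proof.
by rewrite val_submodE -mulmxA -val_submodE in_submodK ?syzygy_stable // mulmxA
  -val_submodE.
Qed.

Lemma syzygy_repr_proof : monoid_mx_repr syzygy_mx.
Proof.
have vE s : val_submod (syzygy_mx s) = val_submod 1%:M *m free_mx s.
  by rewrite -val_syzygy mul1mx.
split=> [|s t]; apply: (can_inj (@val_submodK _ _ K _)).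
  by rewrite vE (proj1 free_mx_repr) mulmx1.
by rewrite val_syzygy !vE -mulmxA -(proj2 free_mx_repr).
Qed.
Definition syzygy := MonoidRepresentation syzygy_repr_proof.

End FreeCover.

Definition syzygy_cover m (r : rep m) :
    'M[k]_(#|{: 'I_(\rank (kermx (free_cover r))) * S}|, #|{: 'I_m * S}|) :=
  val_submod (U := kermx (free_cover r)) (free_cover (syzygy r)).

Variables (n : nat) (rU : rep n).

Fixpoint syzygies i : {m & rep m} :=
  if i is j.+1 then Tagged rep (syzygy (tagged (syzygies j))) else Tagged rep rU.

Lemma syzygy_cover_hom m (r : rep m) :
  hom_mx (free_repr (\rank (kermx (free_cover r)))) (free_repr m) (syzygy_cover r).
Proof.
by move=> s; rewrite -val_syzygy -(free_hom_mx (syzygy r)) val_submodE mulmxA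
  -val_submodE.
Qed.

Lemma syzygy_cover_exact m (r : rep m) : (syzygy_cover r :=: kermx (free_cover r))%MS.
Proof.
apply: eqmx_trans (val_submod1 _); rewrite /syzygy_cover val_submodE.
exact/eqmxMfull/free_cover_full.
Qed.

Lemma kermx_syzygy_cover m (r : rep m) :
  (kermx (syzygy_cover r) :=: kermx (free_cover (syzygy r)))%MS.
Proof.
apply/eqmxP/andP; split; apply/sub_kermxP; last first.
  by rewrite /syzygy_cover val_submodE mulmxA mulmx_ker mul0mx.
apply: (can_inj (@val_submodK _ _ (kermx (free_cover r)) _)).
by rewrite linear0 val_submodE -mulmxA -val_submodE mulmx_ker.
Qed.

Lemma projective_resolution_exists : projective_resolution rU.
Proof.
apply: (@ProjectiveResolution _ _ _ rU _ (fun i => free_repr (tag (syzygies i)))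
  (fun i => syzygy_cover (tagged (syzygies i))) (free_cover rU)).
- by move=> i; apply: free_projective.
- by move=> i; apply: syzygy_cover_hom.
- exact: free_hom_mx.
- exact: free_cover_full.
- exact: syzygy_cover_exact.
- move=> i; apply: eqmx_trans (syzygy_cover_exact _) (eqmx_sym _).
  exact: kermx_syzygy_cover.
Qed.

End ResolutionExists.

Section Bimodule.
Variables (k : fieldType) (H G : finGroupType).
Local Open Scope ring_scope.

(* A kH-kG-bimodule structure on 'rV_m: h and g act by v |-> v *m L h and
   v |-> v *m R g, so that L reverses products. *)
Structure mx_bimodule m := MxBimodule {
  bimod_left : H -> 'M[k]_m;
  bimod_right : mx_representation k [set: G] m;
  bimod_left1 : bimod_left 1%g = 1%:M;
  bimod_leftM : forall h h',
    bimod_left (h * h')%g = bimod_left h' *m bimod_left h;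
  bimodC : forall h g,
    bimod_left h *m bimod_right g = bimod_right g *m bimod_left h
}.

Section SubBimodule.
Variables (m : nat) (B : mx_bimodule m) (W : 'M[k]_m).
Hypothesis WL : forall h, (W *m bimod_left B h <= W)%MS.
Hypothesis WR : mxmodule (bimod_right B) W.

Definition sub_bimod_left h : 'M[k]_(\rank W) :=
  in_submod W (val_submod 1%:M *m bimod_left B h).

Lemma sub_bimod_stable p (x : 'M_(p, \rank W)) h :
  (val_submod x *m bimod_left B h <= W)%MS.
Proof. by apply: submx_trans (WL h); rewrite submxMr ?val_submodP. Qed.

Lemma val_sub_bimod_left p (x : 'M_(p, \rank W)) h :
  val_submod (x *m sub_bimod_left h) = val_submod x *m bimod_left B h.
Proof.
by rewrite /sub_bimod_left val_submodE -mulmxA -val_submodE in_submodK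
  ?sub_bimod_stable // mulmxA -val_submodE.
Qed.

Lemma sub_bimod_left1 : sub_bimod_left 1%g = 1%:M.
Proof. by rewrite /sub_bimod_left bimod_left1 mulmx1 val_submodK. Qed.

Lemma sub_bimod_leftM h h' :
  sub_bimod_left (h * h')%g = sub_bimod_left h' *m sub_bimod_left h.
Proof.
apply: (can_inj (@val_submodK _ _ W _)); rewrite val_sub_bimod_left.
rewrite {2}/sub_bimod_left in_submodK ?sub_bimod_stable //.
by rewrite in_submodK ?sub_bimod_stable // bimod_leftM mulmxA.
Qed.

Lemma sub_bimodC h g :
  sub_bimod_left h *m submod_repr WR g = submod_repr WR g *m sub_bimod_left h.
Proof.
have vL : val_submod (sub_bimod_left h) = val_submod 1%:M *m bimod_left B h.
  by rewrite -val_sub_bimod_left mul1mx.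
have vR : val_submod (submod_mx WR g) = val_submod 1%:M *m bimod_right B g.
  by rewrite -(val_submodJ WR) ?inE // mul1mx.
apply: (can_inj (@val_submodK _ _ W _)); rewrite val_sub_bimod_left vR.
by rewrite val_submodJ ?inE // vL -!mulmxA bimodC.
Qed.

Definition sub_bimod : mx_bimodule (\rank W) :=
  MxBimodule sub_bimod_left1 sub_bimod_leftM sub_bimodC.
End SubBimodule.

Section Tensor.
Variables (n m : nat) (rU : mx_representation k [set: H] n) (B : mx_bimodule m).

(* U (x)_k B is 'M_(n, m) (flattened by mxvec), with u (x) v = u^T *m v. *)
Definition tensor_act (g : G) : 'M[k]_(n * m) := lin_mulmxr (bimod_right B g).

Lemma tensor_act_repr : mx_repr [set: G] tensor_act.
Proof.
split=> [|g g' _ _]; apply/row_matrixP => i; rewrite rowE.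
  rewrite -[delta_mx 0 i]vec_mxK mul_vec_lin /= repr_mx1 mulmx1.
  by rewrite vec_mxK row1.
rewrite row_mul rowE -[delta_mx 0 i]vec_mxK !mul_vec_lin /= repr_mxM ?inE //.
by rewrite mulmxA.
Qed.
Definition tensor_repr := MxRepresentation tensor_act_repr.

(* The span of the elements (u * h) (x) v - u (x) (h * v): the h-th summand is the
   image of A |-> (rU h)^T *m A - A *m bimod_left B h. *)
Definition balanced_rel : 'M[k]_(n * m) :=
  (\sum_(h : H) (lin_mulmx (rU h)^T - lin_mulmxr (bimod_left B h)))%MS.

Lemma balanced_rel_module : mxmodule tensor_repr balanced_rel.
Proof.
apply/mxmoduleP => g _; rewrite /balanced_rel sumsmxMr_gen; apply/sumsmx_subP=> h _.
apply: submx_trans (sumsmx_sup h _ (submx_refl _)) => //.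
have -> : (lin_mulmx (rU h)^T - lin_mulmxr (bimod_left B h)) *m tensor_repr g
   = tensor_act g *m (lin_mulmx (rU h)^T - lin_mulmxr (bimod_left B h)).
  apply/row_matrixP => i; rewrite !row_mul !rowE -[delta_mx 0 i]vec_mxK.
  rewrite mulmxBr !mul_vec_lin /= mulmxBl mulmxBr !mul_vec_lin /=.
  by rewrite -!mulmxA -bimodC mulmxA.
by rewrite genmxE submxMl.
Qed.

(* The right kG-module U (x)_kH B. *)
Definition tensor_over := factmod_repr balanced_rel_module.
End Tensor.
End Bimodule.

(* The number of factors isomorphic to V in a composition series Ws (for whose
   existence and uniqueness see mx_Schreier and mx_JordanHolder). *)
Definition multiplicity (k : fieldType) (G : finGroupType) n p
    (rV : mx_representation k [set: G] n) (rT : mx_representation k [set: G] p)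
    (Ws : seq 'M[k]_p) (compWs : mx_composition_series rT Ws) : nat :=
  #|[set i : 'I_(size Ws) | `[< mx_rsim rV (series_repr i compWs) >]]|.

Section UnitsModule.
Variables (k : fieldType) (S : finMonoidType) (n : nat).
Variable rV : mx_representation k [set: units_group S] n.

Lemma units_setM (s t : S) :
  (s * t \in units_set S) = (s \in units_set S) && (t \in units_set S).
Proof.
have uP (x : S) : reflect (exists y, x * y = 1 /\ y * x = 1) (x \in units_set S).
  apply: (iffP (max_subgroup_setP _ _)) => /=.
    by case=> _ _ [y [_ _ xy yx]]; exists y.
  case=> y [xy yx]; rewrite !mul1g !mulg1; split=> //.
  by exists y; rewrite !mul1g !mulg1.
have linv (x y : S) : x * y = 1 -> y * x = 1.
  move=> xy; have injy : injective ( *%g^~ x).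
    by move=> a b /= /(congr1 ( *%g^~ y)); rewrite /= -!mulgA xy !mulg1.
  have z1 := f_invF injy 1; rewrite /= in z1; set z := invF injy 1 in z1.
  by rewrite -[y]mul1g -[in LHS]z1 -!mulgA (mulgA x) xy mul1g.
apply/uP/andP => [[u [stu ust]] | [/uP[s' [ss' s's]] /uP[t' [tt' t't]]]].
  split; apply/uP.
    by exists (t * u); split; last apply: linv; rewrite mulgA.
  by exists (u * s); split; first apply: linv; rewrite -mulgA.
exists (t' * s').
by rewrite -mulgA (mulgA t) tt' mul1g ss' -mulgA (mulgA s') s's mul1g t't.
Qed.

Local Open Scope ring_scope.

Definition tilde_units_mx (s : S) : 'M[k]_n :=
  if insub s is Some g then rV (g : units_group S) else 0.

Lemma tilde_units_mxT s (us : s \in units_set S) :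
  tilde_units_mx s = rV (Sub s us : units_group S).
Proof.
rewrite /tilde_units_mx; case: insubP => [g _ gs|]; last by rewrite us.
by congr (rV _); apply: val_inj.
Qed.

Lemma tilde_units_mxF s : s \notin units_set S -> tilde_units_mx s = 0.
Proof. by rewrite /tilde_units_mx; case: insubP => [g -> |]. Qed.

Lemma tilde_units_repr : monoid_mx_repr tilde_units_mx.
Proof.
split=> [|s t].
  rewrite (tilde_units_mxT (max_subgroup_one_subproof (idem1 S))).
  by rewrite -(repr_mx1 rV); congr (rV _); apply: val_inj.
case: (boolP (s \in units_set S)) => su; last first.
  by rewrite (tilde_units_mxF su) mul0mx tilde_units_mxF // units_setM (negPf su).
case: (boolP (t \in units_set S)) => tu; last first.
  rewrite (tilde_units_mxF tu) mulmx0 tilde_units_mxF //.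
  by rewrite units_setM (negPf tu) andbF.
have stu : (s * t)%g \in units_set S by rewrite units_setM su.
rewrite (tilde_units_mxT su) (tilde_units_mxT tu) (tilde_units_mxT stu).
by rewrite -repr_mxM ?inE //; congr (rV _); apply: val_inj.
Qed.

Definition tilde_units := MonoidRepresentation tilde_units_repr.

End UnitsModule.

Section MinimalIdeal.
Variables (k : fieldType) (S : finMonoidType).
Hypothesis rrbgS : right_regular_band_of_groups S.
Variables (J : {set S}) (e0 : idempotent_of S).
Local Notation e := (idem_val e0).
Hypothesis minJ : minimal_ideal J.
Hypothesis eJ : e \in J.

Local Notation H := (max_subgroup e0).
Local Notation G := (units_group S).

Lemma right_ideal_mull (x s : S) : exists t, s * x = x * t.
Proof.
pose A := [set x * t | t in [set: S]].
have Ar : right_ideal A.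
  by move=> _ r /imsetP[t _ ->]; rewrite -mulgA; apply/imsetP; exists (t * r).
have [Al _] := rrbgS.2 A Ar.
have xA : x \in A by apply/imsetP; exists 1; rewrite ?mulg1 ?inE.
by have /imsetP[t _ ->] := Al _ s xA; exists t.
Qed.

Lemma mul_idem_minimal (s : S) : e * (s * e) = s * e.
Proof. by have [t ->] := right_ideal_mull e s; rewrite mulgA idemM. Qed.

Lemma minimal_idealE (x : S) : x \in J -> J = [set x * t | t in [set: S]].
Proof.
move=> xJ; case: minJ => [[_ Jr] _ minA]; apply/esym/minA.
- apply: (rrbgS.2) => _ r /imsetP[t _ ->]; rewrite -mulgA.
  by apply/imsetP; exists (t * r).
- by apply/set0Pn; exists (x * 1); apply/imsetP; exists 1; rewrite ?inE.
- by apply/subsetP=> _ /imsetP[t _ ->]; apply: Jr.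
Qed.

Lemma minimal_right_inverse (x : S) : x \in J -> exists t, x * t = e.
Proof.
by move/minimal_idealE=> JE; move: eJ; rewrite JE => /imsetP[t _ ->]; exists t.
Qed.

Lemma idem_mul_minimal (x : S) : x \in J -> e * x = x.
Proof. by rewrite (minimal_idealE eJ) => /imsetP[t _ ->]; rewrite mulgA idemM. Qed.

Lemma mul_idem_in_max_subgroup (s : S) : s * e \in max_subgroup_set e0.
Proof.
have right_inv x : exists y, [/\ e * y = y, y * e = y & x * e * y = e].
  have [|t xt] := @minimal_right_inverse (x * e).
    by case: minJ => [[Jl _] _ _]; apply: Jl.
  exists (e * t * e); rewrite !mulgA idemM; split=> //.
    by rewrite -mulgA idemM.
  by rewrite -(mulgA x) idemM xt idemM.
have [y [ey ye sy]] := right_inv s.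
apply/max_subgroup_setP; split; first exact: mul_idem_minimal.
  by rewrite -mulgA idemM.
exists y; split=> //.
have [z [ez ze yz]] := right_inv y; rewrite ye in yz.
suff -> : s * e = z by [].
by rewrite -ez -[in RHS]sy -!mulgA yz idemM.
Qed.

Lemma max_subgroup_minimal :
  max_subgroup_set e0 = [set e * x * e | x in J].
Proof.
apply/setP=> x; apply/idP/imsetP => [/max_subgroup_setP[ex xe _] | [y _ ->]].
  exists x; last by rewrite ex xe.
  by rewrite -xe; case: minJ => [[Jl _] _ _]; apply: Jl.
exact: mul_idem_in_max_subgroup.
Qed.

(* s |-> se, a monoid homomorphism from S onto H. *)
Definition to_H (s : S) : H := Sub (s * e) (mul_idem_in_max_subgroup s).

Lemma to_H1 : to_H 1 = 1.
Proof. by apply: val_inj; rewrite SubK mul1g. Qed.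

Lemma to_HM s t : to_H (s * t) = to_H s * to_H t.
Proof. by apply: val_inj; rewrite /= -!mulgA mul_idem_minimal. Qed.

Lemma to_H_val (h : H) : to_H (val h) = h.
Proof. by apply: val_inj => /=; case/max_subgroup_setP: (valP h). Qed.

Section Inflation.
Variables (n : nat) (rU : mx_representation k [set: H] n).

Lemma tilde_minimal_repr : monoid_mx_repr (fun s => rU (to_H s)).
Proof.
by split=> [|s t]; rewrite ?to_H1 ?repr_mx1 // to_HM repr_mxM ?inE.
Qed.
Definition tilde_minimal := MonoidRepresentation tilde_minimal_repr.
End Inflation.

Definition minJ_type : Type := {x : S | x \in J}.
HB.instance Definition _ := Finite.on minJ_type.

(* The side condition on w says that w lies in I but not in J, where I is the
   complement of G. *)
Definition smile : rel minJ_type := fun x x' =>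
  (val x * e == val x' * e) &&
  [exists w : S, [&& w \notin units_set S, w \notin J,
                     val x * w == val x & val x' * w == val x']].

Lemma smile_sym : symmetric smile.
Proof.
move=> x y; rewrite /smile eq_sym; congr (_ && _).
by apply: eq_existsb => w; rewrite [(val x * w == _) && _]andbC.
Qed.

(* As smile is symmetric, connect smile is the generated equivalence. *)
Definition approx_equiv : equiv_rel minJ_type :=
  EquivRel (connect smile) (@connect0 _ smile)
    (sym_connect_sym smile_sym) (@connect_trans _ smile).

(* The set X of classes; X_class x is [x]. *)
Definition quotJ : Type := {eq_quot approx_equiv}%qT.
HB.instance Definition _ := Quotient.on quotJ.
HB.instance Definition _ := EqQuotient.on quotJ.
HB.instance Definition _ := Choice.on quotJ.
HB.instance Definition _ := Countable.copy quotJ (can_type (@reprK _ quotJ)).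
HB.instance Definition _ : isFinite quotJ := CanIsFinite (@reprK _ quotJ).

Definition X_class (x : minJ_type) : quotJ := \pi_quotJ%qT x.
Definition X_repr (c : quotJ) : minJ_type := generic_quotient.repr c.

Lemma X_reprK : cancel X_repr X_class.
Proof. exact: (@reprK _ quotJ). Qed.

Lemma X_classP x y : reflect (X_class x = X_class y) (connect smile x y).
Proof.
apply: (iffP idP) => [xy | /(@eqmodP _ approx_equiv _ _)//].
exact/(@eqmodP _ approx_equiv _ _).
Qed.

Definition X_map (f : minJ_type -> minJ_type) (c : quotJ) : quotJ :=
  X_class (f (X_repr c)).

Lemma X_mapE f x : {homo f : x y / smile x y} -> X_map f (X_class x) = X_class (f x).
Proof.
move=> smile_f; apply/X_classP.
have /X_classP : X_class (X_repr (X_class x)) = X_class x by rewrite X_reprK.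
move/connectP=> [p]; elim: p (X_repr _) => [|z p IH] y /=.
  by move=> _ ->; exact: connect0.
case/andP=> yz /IH pz /pz; apply: connect_trans.
exact/connect1/smile_f.
Qed.

Lemma X_map_comp f g c : {homo f : x y / smile x y} ->
  X_map f (X_map g c) = X_map (f \o g) c.
Proof. by move=> smile_f; rewrite {2}/X_map X_mapE. Qed.

Lemma minJ_mull_subproof (s : S) (x : minJ_type) : s * val x \in J.
Proof. by case: minJ => [[Jl _] _ _]; apply/Jl/valP. Qed.

Lemma minJ_mulr_subproof (s : S) (x : minJ_type) : val x * s \in J.
Proof. by case: minJ => [[_ Jr] _ _]; apply/Jr/valP. Qed.

Definition minJ_mull (s : S) (x : minJ_type) : minJ_type :=
  Sub (s * val x) (minJ_mull_subproof s x).

Definition minJ_mulr (s : S) (x : minJ_type) : minJ_type :=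
  Sub (val x * s) (minJ_mulr_subproof s x).

Lemma smile_mull (s : S) : {homo minJ_mull s : x y / smile x y}.
Proof.
move=> x y /andP[/eqP xye /existsP[w /and4P[wG wJ /eqP xw /eqP yw]]].
rewrite /smile /= -!mulgA xye eqxx /=; apply/existsP; exists w.
by rewrite wG wJ -!mulgA xw yw !eqxx.
Qed.

Lemma smile_mulr (g : G) : {homo minJ_mulr (val g) : x y / smile x y}.
Proof.
move=> x y /andP[/eqP xye /existsP[w /and4P[wG wJ /eqP xw /eqP yw]]].
have gV : val g * val g^-1 = 1 := congr1 val (mulgV g).
have wE : val g * (val g^-1 * w * val g) * val g^-1 = w.
  by rewrite !mulgA gV mul1g -mulgA gV mulg1.
rewrite /smile /= -!mulgA -(mul_idem_minimal (val g)) !(mulgA _ e) xye eqxx /=.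
apply/existsP; exists (val g^-1 * w * val g).
rewrite !mulgA -!(mulgA _ (val g)) gV !mulg1 xw yw !eqxx !andbT.
apply/andP; split; last first.
  apply: contra wJ => w'J; rewrite -wE; case: minJ => [[Jl Jr] _ _].
  by apply/Jr/Jl.
by rewrite !units_setM !negb_and wG orbT.
Qed.

Definition X_left (h : H) : quotJ -> quotJ := X_map (minJ_mull (val h)).
Definition X_right (g : G) : quotJ -> quotJ := X_map (minJ_mulr (val g)).

(* The map [x] |-> xe from X to H; its linear extension is epsilon. *)
Definition X_eps (c : quotJ) : H := to_H (val (X_repr c)).

Lemma X_epsE x : X_eps (X_class x) = to_H (val x).
Proof.
rewrite /X_eps.
have /X_classP : X_class (X_repr (X_class x)) = X_class x by rewrite X_reprK.
move/connectP=> [p]; elim: p (X_repr _) => [|z p IH] y /=; first by move=> _ ->.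
case/andP=> /andP[/eqP yz _] /IH pz /pz <-.
by apply: val_inj.
Qed.

Lemma X_eps_left h c : X_eps (X_left h c) = h * X_eps c.
Proof. by rewrite X_epsE /= to_HM to_H_val. Qed.

Lemma X_eps_right g c : X_eps (X_right g c) = X_eps c * to_H (val g).
Proof. by rewrite X_epsE /= to_HM. Qed.

Lemma X_left1 c : X_left 1 c = c.
Proof.
rewrite -[RHS]X_reprK; congr X_class; apply: val_inj => /=.
exact/idem_mul_minimal/valP.
Qed.

Lemma X_leftM h h' c : X_left (h * h') c = X_left h (X_left h' c).
Proof.
rewrite /X_left X_map_comp; last exact: smile_mull.
by congr X_class; apply: val_inj; rewrite /= mulgA.
Qed.

Lemma X_right1 c : X_right 1 c = c.
Proof.
by rewrite -[RHS]X_reprK; congr X_class; apply: val_inj; rewrite /= mulg1.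
Qed.

Lemma X_rightM g g' c : X_right (g * g') c = X_right g' (X_right g c).
Proof.
rewrite /X_right X_map_comp; last exact: smile_mulr.
by congr X_class; apply: val_inj; rewrite /= mulgA.
Qed.

Lemma X_leftC h g c : X_left h (X_right g c) = X_right g (X_left h c).
Proof.
rewrite /X_left /X_right X_map_comp; last exact: smile_mull.
rewrite X_map_comp; last exact: smile_mulr.
by congr X_class; apply: val_inj; rewrite /= mulgA.
Qed.

Local Open Scope ring_scope.

Definition kX_left (h : H) : 'M[k]_#|{: quotJ}| := fun_mx k (X_left h).
Definition kX_right (g : G) : 'M[k]_#|{: quotJ}| := fun_mx k (X_right g).

Lemma kX_right_repr : mx_repr [set: G] kX_right.
Proof.
split=> [|g g' _ _]; first exact/fun_mx_id/X_right1.
by apply/esym/fun_mx_comp => c; rewrite /= X_rightM.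
Qed.

Lemma kX_left1 : kX_left 1%g = 1%:M.
Proof. exact/fun_mx_id/X_left1. Qed.

Lemma kX_leftM h h' : kX_left (h * h')%g = kX_left h' *m kX_left h.
Proof. by apply/esym/fun_mx_comp => c; rewrite /= X_leftM. Qed.

Lemma kX_leftC h g : kX_left h *m kX_right g = kX_right g *m kX_left h.
Proof.
rewrite (@fun_mx_comp _ _ _ _ _ _ (fun c => X_left h (X_right g c))).
  by apply/esym/fun_mx_comp.
by move=> c; rewrite /= X_leftC.
Qed.

Definition kX : mx_bimodule k H G #|{: quotJ}| :=
  @MxBimodule k H G _ kX_left (MxRepresentation kX_right_repr)
    kX_left1 kX_leftM kX_leftC.

Definition epsilon : 'M[k]_(#|{: quotJ}|, #|{: H}|) := fun_mx k X_eps.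

Lemma epsilon_left h :
  kX_left h *m epsilon = epsilon *m fun_mx k (fun a : H => (h * a)%g).
Proof.
rewrite (@fun_mx_comp _ _ _ _ _ _ (fun c => (h * X_eps c)%g)).
  by apply/esym/fun_mx_comp.
by move=> c; rewrite /= X_eps_left.
Qed.

Lemma epsilon_right g :
  kX_right g *m epsilon = epsilon *m fun_mx k (fun a : H => (a * to_H (val g))%g).
Proof.
rewrite (@fun_mx_comp _ _ _ _ _ _ (fun c => (X_eps c * to_H (val g))%g)).
  by apply/esym/fun_mx_comp.
by move=> c; rewrite /= X_eps_right.
Qed.

Lemma ker_epsilon_left h : (kermx epsilon *m bimod_left kX h <= kermx epsilon)%MS.
Proof.
by apply/sub_kermxP; rewrite -mulmxA epsilon_left mulmxA mulmx_ker mul0mx.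
Qed.

Lemma ker_epsilon_right : mxmodule (bimod_right kX) (kermx epsilon).
Proof.
apply/mxmoduleP => g _; apply/sub_kermxP.
by rewrite -mulmxA epsilon_right mulmxA mulmx_ker mul0mx.
Qed.

Definition bimoduleM := sub_bimod ker_epsilon_left ker_epsilon_right.

End MinimalIdeal.

(* Main.v *)
(* Ext^1(U~, V~) is computed by 1-cocycles c : S -> Hom_k(U, V), that is,
   c(st) = s c(t) + c(s) t. As e acts as 1 on U~ and as 0 on V~, each class has
   exactly one representative with c(e) = 0, and then c(s) = c(es) and c(se) = 0.
   If xw = x and x'w = x' with w outside G, then c(x) = x c(w) and c(x') = x' c(w),
   so c is constant on the classes of X and extends linearly to kX. Its
   restriction to M is determined by the values c(s) on the spanning elements
   [es] - [se] and yields a kG-map from the tensor product of U and M over kH to V;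
   conversely c(s)(u) = phi (u (x) ([es] - [se])) is such a cocycle, because
   [est] = [set] for t outside G. Finally kG is semisimple by Maschke's theorem, so
   the maps to V from a kG-module W form a space whose dimension is additive along
   a composition series of W, and each factor contributes 1 or 0 by Schur's lemma. *)

From HB Require Import structures.
Require Import Defs.
From mathcomp Require Import all_boot all_order all_algebra all_fingroup.
From mathcomp Require Import pgroup boolp mxrepresentation ring zify.

Set Implicit Arguments.
Unset Strict Implicit.
Unset Printing Implicit Defensive.

Import GRing.Theory.
Local Open Scope ring_scope.

(** * First extensions by cocycles *)

(** Rank-nullity with image and kernel described by membership, for the dimension counts below. *)
Lemma dimv_surj (k : fieldType) (aT rT : vectType k) (f : {linear aT -> rT})
    (U K : {vspace aT}) (W : {vspace rT}) :
    (forall u, u \in U -> f u \in W) ->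
    (forall w, w \in W -> exists2 u, u \in U & f u = w) ->
    (forall u, u \in K <-> u \in U /\ f u = 0) ->
  \dim U = (\dim K + \dim W)%N.
Proof.
move=> fU fW fK; rewrite -(limg_ker_dim (linfun f) U); congr (_ + _)%N; congr (\dim _).
  apply/vspaceP=> u; rewrite memv_cap memv_ker lfunE /=.
  by apply/andP/idP => [[uU /eqP fu]|/fK[uU ->]]; [apply/fK | rewrite eqxx].
apply/vspaceP=> w; apply/memv_imgP/idP => [[u uU ->]|/fW[u uU <-]].
  by rewrite lfunE; apply: fU.
by exists u; rewrite ?lfunE.
Qed.

(** The rows of [A *m pinvmx A - 1%:M] lie in the left kernel of [A], which [B] kills; so [B]
    factors through [A]. *)
Lemma mulmx_pinvmx_ker (k : fieldType) m n p (A : 'M[k]_(m, n)) (B : 'M_(m, p)) :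
  kermx A *m B = 0 -> A *m (pinvmx A *m B) = B.
Proof.
move=> AB; apply/eqP; rewrite mulmxA -subr_eq0 -[X in _ - X]mul1mx -mulmxBl.
have /submxP[D ->] : (A *m pinvmx A - 1%:M <= kermx A)%MS.
  by apply/sub_kermxP; rewrite mulmxBl mul1mx mulmxKpV ?subrr.
by rewrite -mulmxA AB mulmx0.
Qed.

Section Cocycles.
Variables (k : fieldType) (S : finMonoidType) (m n : nat).
Variables (rU : monoid_representation k S m) (rV : monoid_representation k S n).
Local Notation cochain := {ffun S -> 'M[k]_(m, n)}.

Definition mx_cocycle (c : S -> 'M[k]_(m, n)) : Prop :=
  forall s t, c (s * t)%g = rU s *m c t + c s *m rV t.

Definition cocycle_defect (p : S * S) (c : cochain) : 'M[k]_(m, n) :=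
  c (p.1 * p.2)%g - (rU p.1 *m c p.2 + c p.1 *m rV p.2).

Fact cocycle_defect_linear p : linear (cocycle_defect p).
Proof.
move=> a c d; rewrite /cocycle_defect !ffunE mulmxDr mulmxDl -scalemxAr -scalemxAl.
move: (rU _ *m _) (_ *m rV _) (rU _ *m _) (_ *m rV _) => x y x' y'.
by apply/matrixP=> i j; rewrite !mxE; ring.
Qed.
HB.instance Definition _ p := GRing.isLinear.Build k cochain 'M[k]_(m, n) _
  (cocycle_defect p) (cocycle_defect_linear p).

Definition cocycle_space : {vspace cochain} :=
  (\bigcap_(p : S * S) lker (linfun (cocycle_defect p)))%VS.

Lemma cocycle_spaceP (c : cochain) : c \in cocycle_space <-> mx_cocycle c.
Proof.
rewrite /cocycle_space memvE; split=> [/subv_bigcapP Hc s t | Hc].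
  have := Hc (s, t) isT.
  by rewrite -memvE memv_ker lfunE /= => /eqP/subr0_eq.
apply/subv_bigcapP=> -[s t] _; rewrite -memvE memv_ker lfunE /=.
by rewrite /cocycle_defect /= Hc subrr.
Qed.

Lemma mx_cocycle1 c : mx_cocycle c -> c 1%g = 0.
Proof.
move=> /(_ 1%g 1%g); rewrite mulg1 !monoid_repr1 mul1mx mulmx1 => /eqP.
by rewrite -subr_eq0 opprD addrA subrr add0r oppr_eq0 => /eqP.
Qed.

Section Extension.
Variable c : S -> 'M[k]_(m, n).
Hypothesis cP : mx_cocycle c.

(** The extension of U by V attached to [c]: [s] sends (u, v) to (us, u c(s) + vs), and
    multiplicativity is the cocycle identity. *)
Definition extension_mx (s : S) : 'M[k]_(m + n) := block_mx (rU s) (c s) 0 (rV s).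

Fact extension_repr_proof : monoid_mx_repr extension_mx.
Proof.
split=> [|s t]; rewrite /extension_mx.
  by rewrite !monoid_repr1 mx_cocycle1 // -scalar_mx_block.
by rewrite mulmx_block !monoid_reprM cP !(mul0mx, mulmx0, addr0, add0r).
Qed.
Definition extension_repr := MonoidRepresentation extension_repr_proof.

Lemma extension_proj_hom : hom_mx extension_repr rU (col_mx 1%:M 0).
Proof.
move=> s; rewrite mul_block_col mul_col_mx !mulmx1 !mul0mx mul1mx !mulmx0.
by rewrite !addr0.
Qed.

Lemma extension_proj_full : row_full (col_mx 1%:M 0 : 'M[k]_(m + n, m)).
Proof.
apply/row_fullP; exists (row_mx 1%:M 0).
by rewrite mul_row_col mul1mx mul0mx addr0.
Qed.

End Extension.

(** The space [T] below is counted twice: it maps onto [cocycle_space] with kernel Hom_kS(P_0, V),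
    and onto the 1-cocycles of the resolution with kernel Hom_k(U, V). *)
Lemma dim_Ext1E (P : projective_resolution rU) :
  (dim_Ext P rV 1 + m * n = \dim cocycle_space + \dim (Hom_space rU rV))%N.
Proof.
set aug := res_aug P; set d0 := res_diff P 0; set d1 := res_diff P 1.
have augF : row_full aug := res_aug_surj P.
have d0aug : d0 *m aug = 0 by apply/sub_kermxP; rewrite res_aug_exact.
have augI q : injective (mulmx aug : 'M_(m, q) -> _).
  by move=> A B /(congr1 (mulmx (pinvmx aug))); rewrite !mulmxA mulVpmx // !mul1mx.
(* The linear maps P_0 -> V whose composite with [d0] is a homomorphism P_1 -> V. *)
pose T := (linfun (mulmx d0) @^-1: Hom_space (res_mod P 1) rV)%VS.
have TP g : g \in T <-> hom_mx (res_mod P 1) rV (d0 *m g).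
  by rewrite /T -memv_preim lfunE; apply: Hom_spaceP.
(* [defect g s] is [aug *m c s] for the cocycle [c] attached to [g] in [T] *)
pose defect (g : 'M_(_, n)) s := res_mod P 0 s *m g - g *m rV s.
have d0_defect g s : g \in T -> d0 *m defect g s = 0.
  move=> /TP /(_ s) gT; rewrite mulmxBr !mulmxA -res_diff_hom.
  by rewrite -[_ *m d0 *m g]mulmxA gT subrr.
have aug_defect g s : g \in T -> aug *m (pinvmx aug *m defect g s) = defect g s.
  move=> gT; apply: mulmx_pinvmx_ker.
  have /submxP[D ->] : (kermx aug <= d0)%MS by rewrite res_aug_exact.
  by rewrite -mulmxA d0_defect // mulmx0.
have HomT g : g \in Hom_space (res_mod P 0) rV <-> forall s, defect g s = 0.
  by rewrite Hom_spaceP; split=> H s; [rewrite /defect H subrr | apply/subr0_eq/H].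
pose C (g : 'M[k]_(res_dim P 0, n)) : cochain :=
  [ffun s => pinvmx aug *m defect g s].
have C_lin : linear C.
  move=> a g h; apply/ffunP=> s; rewrite !ffunE /defect scalemxAr -mulmxDr.
  congr (_ *m _); rewrite mulmxDr mulmxDl -scalemxAr -scalemxAl scalerBr opprD.
  by rewrite addrACA.
pose Cl : {linear _ -> _} := HB.pack C (GRing.isLinear.Build k _ _ _ C C_lin).
have dimT1 : \dim T = (\dim (Hom_space (res_mod P 0) rV) + \dim cocycle_space)%N.
  apply: (@dimv_surj _ _ _ Cl).
  - move=> g gT; apply/cocycle_spaceP=> s t; rewrite !ffunE; apply: augI.
    rewrite mulmxDr aug_defect // [in RHS]mulmxA -res_aug_hom -[in RHS]mulmxA.
    rewrite [aug *m (_ *m rV t)]mulmxA !aug_defect // /defect !monoid_reprM.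
    by rewrite mulmxBr mulmxBl !mulmxA addrA subrK.
  - move=> c /cocycle_spaceP cP.
    (* Projectivity of P_0 lifts [aug] to the extension given by [c]; the V-component of the lift is
       the preimage of [c]. *)
    have [g' g'hom g'aug] := res_projective (extension_proj_hom cP)
      extension_proj_full (res_aug_hom P).
    pose g := rsubmx g'.
    have g'E : g' = row_mx aug g.
      rewrite -[LHS]hsubmxK; congr row_mx; rewrite -[RHS]g'aug.
      by rewrite -[g' in RHS]hsubmxK mul_row_col mulmx1 mulmx0 addr0.
    have gdef s : defect g s = aug *m c s.
      have := g'hom s; rewrite g'E mul_mx_row mul_row_block => /eq_row_mx[_].
      by rewrite /defect => ->; rewrite addrK.
    exists g; last by apply/ffunP=> s; rewrite ffunE gdef mulmxA mulVpmx ?mul1mx.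
    apply/TP=> s; apply/subr0_eq; rewrite mulmxA res_diff_hom -!mulmxA -mulmxBr.
    by rewrite -/(defect g s) gdef mulmxA d0aug mul0mx.
  - move=> g; split=> [/HomT gH | [gT /ffunP Cg]].
      split; last by apply/ffunP=> s; rewrite !ffunE gH mulmx0.
      apply/TP=> s; rewrite mulmxA res_diff_hom -!mulmxA; congr (_ *m _).
      exact/subr0_eq/gH.
    apply/HomT=> s; rewrite -aug_defect //; have := Cg s; rewrite !ffunE => ->.
    by rewrite mulmx0.
have dimT2 : \dim T = (m * n + \dim (cocycles P rV 1))%N.
  have -> : (m * n = \dim (linfun (mulmx aug) @: {: 'M[k]_(m, n)}))%N.
    rewrite limg_dim_eq ?dimvf ?dim_matrix //.
    apply/eqP; rewrite -subv0; apply/subvP=> h; rewrite memv_cap memv_ker lfunE.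
    by rewrite memv0 memvf /= -(mulmx0 _ aug) => /eqP/augI->.
  apply: (@dimv_surj _ _ _ (mulmx d0)).
  - move=> g gT; rewrite memv_cap; apply/andP; split; first exact/Hom_spaceP/TP.
    rewrite memv_ker lfunE /= mulmxA.
    have -> : d1 *m d0 = 0 by apply/sub_kermxP; rewrite res_diff_exact.
    by rewrite mul0mx.
  - move=> f; rewrite memv_cap memv_ker lfunE => /andP[fH /eqP /= d1f].
    (* Since [f] vanishes on ker d0 = im d1, it extends linearly along [d0]. *)
    have d0f : d0 *m (pinvmx d0 *m f) = f.
      apply: mulmx_pinvmx_ker.
      have /submxP[D ->] : (kermx d0 <= d1)%MS by rewrite res_diff_exact.
      by rewrite -mulmxA d1f mulmx0.
    exists (pinvmx d0 *m f) => //.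
    by apply/TP; rewrite d0f; apply/Hom_spaceP.
  - move=> g; split=> [/memv_imgP[h _ ->] | [gT d0g]].
      rewrite lfunE /= mulmxA d0aug mul0mx; split=> //.
      by apply/TP=> s; rewrite !mulmxA -[_ *m d0 *m aug]mulmxA d0aug mulmx0 !mul0mx.
    apply/memv_imgP; exists (pinvmx aug *m g); rewrite ?memvf // lfunE /=.
    rewrite mulmx_pinvmx_ker //.
    have /submxP[D ->] : (kermx aug <= d0)%MS by rewrite res_aug_exact.
    by rewrite -mulmxA d0g mulmx0.
(* The same map on Hom_kS(P_0, V) has the coboundaries as image and Hom_kS(U, V) as kernel. *)
have dimB : \dim (Hom_space (res_mod P 0) rV) =
    (\dim (Hom_space rU rV) + \dim (coboundaries P rV 1))%N.
  have -> : \dim (Hom_space rU rV) =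
      \dim (linfun (mulmx aug) @: Hom_space rU rV).
    rewrite limg_dim_eq //; apply/eqP; rewrite -subv0; apply/subvP=> h.
    rewrite memv_cap memv_ker lfunE /= memv0 -(mulmx0 _ aug).
    by case/andP=> _ /eqP/augI->.
  apply: (@dimv_surj _ _ _ (mulmx d0)).
  - by move=> g gH; apply/memv_imgP; exists g; rewrite ?lfunE.
  - by move=> f /memv_imgP[g gH ->]; exists g; rewrite ?lfunE.
  - move=> g; split=> [/memv_imgP[h /Hom_spaceP hH ->] | [/Hom_spaceP gH d0g]].
      rewrite lfunE /= mulmxA d0aug mul0mx; split=> //.
      by apply/Hom_spaceP=> s; rewrite mulmxA res_aug_hom -!mulmxA hH.
    have gE : aug *m (pinvmx aug *m g) = g.
      apply: mulmx_pinvmx_ker.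
      have /submxP[D ->] : (kermx aug <= d0)%MS by rewrite res_aug_exact.
      by rewrite -mulmxA d0g mulmx0.
    apply/memv_imgP; exists (pinvmx aug *m g); last by rewrite lfunE.
    apply/Hom_spaceP=> s; apply: augI.
    by rewrite mulmxA -res_aug_hom -mulmxA gE mulmxA gE gH.
(* The subtraction in [dim_Ext] is truncated; this inclusion makes it exact. *)
have := dimvS (coboundaries_sub P rV 1).
rewrite /dim_Ext; lia.
Qed.
End Cocycles.

(** * Composition multiplicities *)

Section GroupHom.
Variables (k : fieldType) (G : finGroupType).
Local Notation rep := (mx_representation k [set: G]).

Definition group_hom_space p n (rW : rep p) (rV : rep n) : {vspace 'M[k]_(p, n)} :=
  (\bigcap_(g : G) lker (linfun (mulmx (rW g) \- mulmxr (rV g))))%VS.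

Lemma group_hom_spaceP p n (rW : rep p) (rV : rep n) f :
  f \in group_hom_space rW rV <-> forall g, rW g *m f = f *m rV g.
Proof.
rewrite /group_hom_space memvE; split=> [/subv_bigcapP Hf g | Hf].
  by have := Hf g isT; rewrite -memvE memv_ker lfunE /= => /eqP/subr0_eq.
apply/subv_bigcapP=> g _; rewrite -memvE memv_ker lfunE /=.
by rewrite subr_eq0 Hf.
Qed.

(** Schur: the left kernel of [f] is a submodule, and if nonzero it is everything. *)
Lemma irr_hom_row_free p n (rW : rep p) (rV : rep n) f :
  mx_irreducible rW -> f \in group_hom_space rW rV -> f != 0 -> row_free f.
Proof.
move=> /mx_irrP[_ irrW] /group_hom_spaceP fH nzf; rewrite -kermx_eq0.
apply: contraNT nzf => /irrW; rewrite -sub1mx => /(_ _)/sub_kermxP.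
rewrite mul1mx => ->; rewrite ?eqxx //; apply/mxmoduleP=> g _.
by apply/sub_kermxP; rewrite -mulmxA fH mulmxA mulmx_ker mul0mx.
Qed.

Lemma irr_hom_row_full p n (rW : rep p) (rV : rep n) f :
  mx_irreducible rV -> f \in group_hom_space rW rV -> f != 0 -> row_full f.
Proof.
move=> /mx_irrP[_ irrV] /group_hom_spaceP fH nzf.
(* The image of [f] is a submodule; [genmx] makes it the square matrix that [mx_irrP] expects. *)
rewrite -(eq_row_full (genmxE f)) irrV //; last by rewrite -submx0 genmxE submx0.
rewrite (eqmx_module _ (genmxE _)); apply/mxmoduleP=> g _.
by rewrite -fH submxMl.
Qed.

Lemma irr_hom_rsim p n (rW : rep p) (rV : rep n) f :
    mx_irreducible rW -> mx_irreducible rV ->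
  f \in group_hom_space rW rV -> f != 0 -> mx_rsim rV rW.
Proof.
move=> irrW irrV fH nzf; apply: mx_rsim_sym.
have ff := irr_hom_row_free irrW fH nzf; have fF := irr_hom_row_full irrV fH nzf.
exists f => //; first by rewrite -(eqP ff) (eqP fF).
by move/group_hom_spaceP: fH => fH g _.
Qed.

End GroupHom.

(* An endomorphism f has an eigenvalue a, so f - a is singular, hence 0. *)
Lemma irr_endo_scalar (k : closedFieldType) (G : finGroupType) n
    (rV : mx_representation k [set: G] n) f :
  mx_irreducible rV -> f \in group_hom_space rV rV -> is_scalar_mx f.
Proof.
move=> irrV fH; have n_gt0 : (0 < n)%N by case/mx_irrP: irrV.
have [a /eigenvalueP[v /eqP va nzv]] : exists a, eigenvalue f a.
  have [a] : exists a, root (char_poly f) a.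
    apply/closed_rootP; rewrite size_char_poly; lia.
  by rewrite -eigenvalue_root_char; exists a.
apply/is_scalar_mxP; exists a; apply/subr0_eq/eqP; apply: contraNT nzv => nzd.
have fF : row_free (f - a%:M).
  apply: (irr_hom_row_free irrV) nzd.
  apply/group_hom_spaceP=> g; rewrite mulmxBr mulmxBl scalar_mxC.
  by have /group_hom_spaceP-> := fH.
apply/eqP/(row_free_inj fF).
by rewrite mul0mx mulmxBr (eqP va) mul_mx_scalar subrr.
Qed.

(** If [B] is an isomorphism from [rV] to [rW], then [f *m B] is an endomorphism of [rW], hence
    scalar, and [f] is a multiple of [invmx B]. *)
Lemma dim_irr_hom (k : closedFieldType) (G : finGroupType) p n
    (rW : mx_representation k [set: G] p) (rV : mx_representation k [set: G] n) :
  mx_irreducible rW -> mx_irreducible rV ->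
  \dim (group_hom_space rW rV) = `[< mx_rsim rV rW >].
Proof.
move=> irrW irrV; case: asboolP => [[B np Bf BH] | nsim]; last first.
  apply/eqP; rewrite dimv_eq0 -subv0; apply/subvP=> f fH; rewrite memv0.
  by apply: contra_notT nsim; apply: irr_hom_rsim.
move: rW irrW B Bf BH; case: p / np => rW irrW B Bf BH.
have Bu : B \in unitmx by rewrite -row_free_unit.
have BiH : invmx B \in group_hom_space rW rV.
  apply/group_hom_spaceP=> g; apply: canRL (mulKmx Bu) _.
  by rewrite mulmxA -BH ?inE // mulmxK.
suff -> : group_hom_space rW rV = <[invmx B]>%VS.
  rewrite dim_vline; suff -> : invmx B != 0 by [].
  apply/eqP=> B0; move: Bu; rewrite -unitmx_inv B0 -row_free_unit /row_free.
  by rewrite mxrank0 => /eqP n0; case/mx_irrP: irrV => n_gt0 _; rewrite -n0 in n_gt0.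
apply/eqP; rewrite eqEsubv -memvE BiH andbT; apply/subvP=> f fH.
have : f *m B \in group_hom_space rW rW.
  apply/group_hom_spaceP=> g; have /group_hom_spaceP fH' := fH.
  by rewrite mulmxA fH' -!mulmxA BH ?inE.
move=> /(irr_endo_scalar irrW)/is_scalar_mxP[a fB].
apply/vlineP; exists a; by rewrite -[f](mulmxK Bu) fB mul_scalar_mx.
Qed.

Section Multiplicity.
Variables (k : closedFieldType) (G : finGroupType) (p n : nat).
Variables (rW : mx_representation k [set: G] p).
Variables (rV : mx_representation k [set: G] n).
Hypotheses (kG : ([pchar k]^'.-group [set: G])%g) (irrV : mx_irreducible rV).

(** In effect Hom_kG(W/A, V). As [A] climbs a composition series, these spaces descend from
    Hom_kG(W, V) to 0. *)
Definition hom_killing (A : 'M[k]_p) : {vspace 'M[k]_(p, n)} :=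
  (group_hom_space rW rV :&: lker (linfun (mulmx A)))%VS.

Lemma hom_killingP A f :
  f \in hom_killing A <-> f \in group_hom_space rW rV /\ A *m f = 0.
Proof.
rewrite memv_cap memv_ker lfunE.
by split=> [/andP[-> /eqP]|[-> /= ->]]; rewrite ?eqxx.
Qed.

(** Restriction to [B] sends maps killing [A] to Hom_kG(B/A, V), with kernel the maps killing [B];
    it is onto by Maschke. *)
Lemma dim_hom_killing A B (modA : mxmodule rW A) (modB : mxmodule rW B) :
    (A <= B)%MS ->
  \dim (hom_killing A) = (\dim (hom_killing B)
     + \dim (group_hom_space (section_repr modA modB) rV))%N.
Proof.
move=> sAB; set sec := section_repr modA modB.
set U := <<in_factmod A B>>%MS.
(* A basis of B/A lifted to W, so that [bas *m f] is the map induced by [f] on B/A. *)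
pose bas : 'M_(_, p) := val_factmod (val_submod (U := U) 1%:M).
have sbB : (bas <= B)%MS.
  apply: submx_trans (_ : val_factmod (in_factmod A B) <= B)%MS.
    by rewrite val_factmodS -(genmxE (in_factmod A B)) val_submodP.
  by apply: submx_trans (proj_factmodS _ _) _; rewrite addsmx_sub sAB submx_refl.
(* Passing to W/A and lifting back changes [X] only by vectors of [A]. *)
have factE (X f : 'M_(_, _)) : A *m f = 0 -> val_factmod (in_factmod A X) *m f = X *m f.
  move=> Af; rewrite -[X in RHS](add_sub_fact_mod A) mulmxDl.
  by have /submxP[D ->] := val_submodP (in_submod A X); rewrite -mulmxA Af mulmx0 add0r.
apply: (@dimv_surj _ _ _ (mulmx bas)).
- move=> f /hom_killingP[/group_hom_spaceP fH Af]; apply/group_hom_spaceP=> g.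
  have secE : val_factmod (val_submod (sec g)) =
      val_factmod (in_factmod A (bas *m rW g)).
    by rewrite -[sec g]mul1mx val_submodJ ?inE // val_factmodJ ?inE.
  rewrite mulmxA [X in X *m f](_ : _ = val_factmod (val_submod (sec g))); last first.
    by rewrite val_submodE val_factmodE -mulmxA -val_factmodE.
  by rewrite secE factE // -!mulmxA fH.
- move=> w /group_hom_spaceP wH.
  (* The projection onto [B] along an invariant complement is a homomorphism; followed by B -> B/A
     and [w], it gives the preimage. *)
  have [C modC BC dxBC] := mx_Maschke_pchar rW kG modB (submx1 _).
  have BC0 : (B :&: C = 0)%MS by apply/mxdirect_addsP.
  pose pr := proj_mx B C.
  have prU : (in_factmod A pr <= U)%MS.
    by rewrite genmxE submxMr // -[pr]mul1mx proj_mx_sub.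
  have prH g : rW g *m pr = pr *m rW g.
    have := proj_mx_hom BC0 modB modC; rewrite BC => /hom_mxP/(_ g).
    by rewrite inE !mul1mx => ->.
  have fE q (X : 'M_(q, p)) : X *m (in_submod U (in_factmod A pr) *m w) =
      in_submod U (in_factmod A (X *m pr)) *m w.
    by rewrite mulmxA; congr (_ *m w); rewrite /in_submod /in_factmod /= !mulmxA.
  exists (in_submod U (in_factmod A pr) *m w).
    apply/hom_killingP; split.
      apply/group_hom_spaceP=> g; rewrite fE prH in_factmodJ ?inE //.
      rewrite (in_submodJ (section_module modA modB)) //.
      by rewrite -[RHS]mulmxA -wH [RHS]mulmxA.
    rewrite fE proj_mx_id //.
    have /eqP-> : in_factmod A A == 0 by rewrite in_factmod_eq0.
    by rewrite linear0 mul0mx.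
  by apply: etrans (fE _ bas) _; rewrite proj_mx_id // val_factmodK val_submodK mul1mx.
- move=> f; split=> [/hom_killingP[fH Bf] | [/hom_killingP[fH Af] bf]].
    have killed q (X : 'M_(q, p)) : (X <= B)%MS -> X *m f = 0.
      by case/submxP=> D ->; rewrite -mulmxA Bf mulmx0.
    by split; last exact: killed; apply/hom_killingP; split; last exact: killed.
  apply/hom_killingP; split=> //; rewrite -(factE _ _ B f Af).
  have -> : val_factmod (in_factmod A B) = in_submod U (in_factmod A B) *m bas.
    rewrite /bas [RHS]mulmxA; congr (_ *m _).
    by rewrite -[RHS]val_submodE in_submodK ?genmxE.
  by rewrite -mulmxA bf mulmx0.
Qed.

(** The previous lemma telescopes along the series, and each simple factor contributes 1 or 0. *)
Lemma dim_hom_multiplicity Ws (compWs : mx_composition_series rW Ws) :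
    (last 0 Ws :=: 1%:M)%MS ->
  \dim (group_hom_space rW rV) = multiplicity rV compWs.
Proof.
move=> lastWs.
have h0 : \dim (group_hom_space rW rV) = \dim (hom_killing (0 :: Ws)`_0).
  congr (\dim _); apply/vspaceP=> f; apply/idP/idP=> [fH|/hom_killingP[]//].
  by apply/hom_killingP; rewrite /= mul0mx.
have hlast : \dim (hom_killing (0 :: Ws)`_(size Ws)) = 0%N.
  apply/eqP; rewrite dimv_eq0 -subv0; apply/subvP=> f /hom_killingP[_].
  rewrite -[size Ws]/(size (0 :: Ws)).-1 nth_last /= => lf; rewrite memv0.
  have /submxP[D D1] : (1%:M <= last 0 Ws)%MS by rewrite lastWs.
  by rewrite -[f]mul1mx D1 -mulmxA lf mulmx0.
have step i : (i < size Ws)%N -> \dim (hom_killing (0 :: Ws)`_i) =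
    (\dim (hom_killing (0 :: Ws)`_i.+1) + `[< mx_rsim rV (series_repr i compWs) >])%N.
  move=> ltiW; rewrite -dim_irr_hom //; last exact: mx_series_repr_irr.
  apply: dim_hom_killing; apply: ltmxW.
  by case: (compWs.2 i ltiW).
have tele j : (j <= size Ws)%N -> \dim (hom_killing (0 :: Ws)`_0) =
   (\dim (hom_killing (0 :: Ws)`_j)
     + \sum_(i < j) `[< mx_rsim rV (series_repr i compWs) >])%N.
  elim: j => [|j IH] ltj; first by rewrite big_ord0 addn0.
  by rewrite big_ord_recr IH ?(ltnW ltj) // step // addnAC addnA.
rewrite h0 (tele _ (leqnn _)) hlast add0n /multiplicity -sum1_card [RHS]big_mkcond /=.
by apply: eq_bigr => i _; rewrite inE; case: (asbool _).
Qed.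

End Multiplicity.

(** * Tensor products over a group algebra *)

Section TensorUniversal.
Variables (k : fieldType) (H G : finGroupType) (m r n : nat).
Variables (rU : mx_representation k [set: H] m) (B : mx_bimodule k H G r).
Local Notation rel := (balanced_rel rU B).

(* The map u |-> u (x) y from U to the tensor product over kH. *)
Definition tensor_mx (y : 'rV[k]_r) : 'M[k]_(m, \rank (cokermx rel)) :=
  \matrix_i in_factmod rel (mxvec ((delta_mx 0 i)^T *m y)).

Lemma mul_tensor_mx u y : u *m tensor_mx y = in_factmod rel (mxvec (u^T *m y)).
Proof.
rewrite [u in RHS]row_sum_delta mulmx_sum_row linear_sum /= mulmx_suml !linear_sum /=.
apply: eq_bigr => i _; rewrite rowK /=.
by rewrite [(_ *: _)^T]linearZ /= -scalemxAl !linearZ.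
Qed.

Fact tensor_mx_linear : linear tensor_mx.
Proof.
move=> a y z; apply/row_matrixP=> i; rewrite [RHS]linearP /= !rowK mulmxDr.
by rewrite -scalemxAr !linearP.
Qed.
HB.instance Definition _ := GRing.isLinear.Build k 'rV[k]_r _ _ tensor_mx
  tensor_mx_linear.

Lemma tensor_mxD y z : tensor_mx (y + z) = tensor_mx y + tensor_mx z.
Proof. exact: linearD. Qed.

(** The balancing relation: row by row, the difference lies in the [h]-th summand of
    [balanced_rel]. *)
Lemma tensor_mx_left h y : rU h *m tensor_mx y = tensor_mx (y *m bimod_left B h).
Proof.
apply/row_matrixP=> i; rewrite !rowE mulmxA !mul_tensor_mx; apply/subr0_eq/eqP.
rewrite -!linearB /= in_factmod_eq0 trmx_mul -mulmxA [X in _ - X]mulmxA.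
set A := _^T *m y.
apply: submx_trans (sumsmx_sup h _ (submx_refl _)) => //.
suff -> : mxvec ((rU h)^T *m A - A *m bimod_left B h) = mxvec A *m
  (lin_mulmx (rU h)^T - lin_mulmxr (bimod_left B h)) by apply: submxMl.
by rewrite mulmxBr !mul_vec_lin /= linearB.
Qed.

Lemma tensor_mx_right g y :
  tensor_mx y *m tensor_over rU B g = tensor_mx (y *m bimod_right B g).
Proof.
apply/row_matrixP=> i; rewrite row_mul !rowK -in_factmodJ ?inE //.
by rewrite mul_vec_lin /= mulmxA.
Qed.

(** The basis matrices [delta_mx i j] are pure tensors. *)
Lemma tensor_rect_ind p (f g : 'M[k]_(m * r, p)) :
    (forall (u : 'rV_m) (y : 'rV_r), mxvec (u^T *m y) *m f = mxvec (u^T *m y) *m g) ->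
  f = g.
Proof.
move=> fg; apply/row_matrixP=> q; rewrite !rowE.
case/mxvec_indexP: q => i j; rewrite -mxvec_delta.
have -> : delta_mx i j = (delta_mx 0 i : 'rV[k]_m)^T *m (delta_mx 0 j : 'rV[k]_r).
  by rewrite trmx_delta mul_delta_mx.
exact: fg.
Qed.

Lemma tensor_mx_inj p (f g : 'M[k]_(_, p)) :
  (forall y, tensor_mx y *m f = tensor_mx y *m g) -> f = g.
Proof.
move=> fg; suff E : in_factmod rel 1%:M *m f = in_factmod rel 1%:M *m g.
  rewrite -[f]mul1mx -[g]mul1mx -(val_factmodK (U := rel) 1%:M) in_factmodE.
  by rewrite -[LHS]mulmxA E [LHS]mulmxA.
apply: tensor_rect_ind => u y; rewrite [LHS]mulmxA [RHS]mulmxA -in_factmodE.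
by rewrite -mul_tensor_mx -[LHS]mulmxA -[RHS]mulmxA fg.
Qed.

(** The universal property: [D] encodes the balanced bilinear map (u, y) |-> [u *m D y]. *)
Lemma tensor_mx_lift (D : {linear 'rV[k]_r -> 'M[k]_(m, n)}) :
    (forall h y, rU h *m D y = D (y *m bimod_left B h)) ->
  exists f, forall y, tensor_mx y *m f = D y.
Proof.
move=> Dbal.
(* The extension to the tensor product over k: the j-th column of the matrix is paired with the j-th
   basis vector of the bimodule. *)
pose F (v : 'rV_(m * r)) := \sum_j row j (vec_mx v)^T *m D (delta_mx 0 j).
have F_lin : linear F.
  move=> a u v; rewrite /F scaler_sumr -big_split; apply: eq_bigr => j _ /=.
  by rewrite !linearP mulmxDl scalemxAl.
pose Fl : {linear _ -> _} := HB.pack F (GRing.isLinear.Build k _ _ _ F F_lin).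
have TE (u : 'rV_m) y : mxvec (u^T *m y) *m lin1_mx Fl = u *m D y.
  rewrite mul_rV_lin1 /= /F mxvecK trmx_mul trmxK {2}[y]row_sum_delta.
  rewrite linear_sum mulmx_sumr; apply: eq_bigr => j _.
  rewrite linearZ /= -scalemxAr row_mul -tr_col [col j y]mx11_scalar.
  by rewrite tr_scalar_mx mul_scalar_mx -scalemxAl mxE.
have Tker : rel *m lin1_mx Fl = 0.
  apply/sub_kermxP/sumsmx_subP=> h _; apply/sub_kermxP.
  rewrite mulmxBl; apply/eqP; rewrite subr_eq0; apply/eqP.
  apply: tensor_rect_ind => u y; rewrite !mulmxA !mul_vec_lin /= mulmxA -trmx_mul.
  by rewrite TE -mulmxA TE -mulmxA Dbal.
exists (val_factmod 1%:M *m lin1_mx Fl) => y; apply/row_matrixP=> i.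
rewrite row_mul rowK mulmxA -val_factmodE rowE -TE.
rewrite -[X in _ = X *m lin1_mx _](add_sub_fact_mod rel) mulmxDl.
have /submxP[Z ->] := val_submodP (in_submod rel (mxvec ((delta_mx 0 i)^T *m y))).
by rewrite -mulmxA Tker mulmx0 add0r.
Qed.

End TensorUniversal.

(** * Extensions between the minimal ideal and the units *)

Lemma delta_fun_mx (k : fieldType) (A B : finType) (f : A -> B) a :
  (delta_mx 0 (enum_rank a) : 'rV_#|A|) *m fun_mx k f = delta_mx 0 (enum_rank (f a)).
Proof.
rewrite -rowE; apply/rowP=> j; rewrite !mxE enum_rankK eqxx /=.
by rewrite -[j in RHS]enum_valK (inj_eq enum_rank_inj) eq_sym.
Qed.

Section MinimalExt.
Variables (k : closedFieldType) (S : finMonoidType).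
Hypothesis rrbgS : right_regular_band_of_groups S.
Variables (J : {set S}) (minJ : minimal_ideal J) (e0 : idempotent_of S).
Local Notation e := (idem_val e0).
Hypotheses (GneqJ : units_set S != J) (eJ : e \in J).
Local Notation H := (max_subgroup e0).
Local Notation G := (units_group S).
Local Notation toH := (to_H rrbgS minJ eJ).
Local Notation M := (bimoduleM k rrbgS minJ eJ).
Local Notation eps := (epsilon k rrbgS minJ eJ).
Local Notation XJ := (quotJ J e0).

(** An idempotent unit is 1; then [J] is all of S and each s = se is a unit, against [GneqJ]. *)
Lemma idem_minimal_nonunit : e \notin units_set S.
Proof.
apply: contra_neqN GneqJ => eU.
have e1 : e = 1%g.
  case/max_subgroup_setP: eU => /= _ _ [y [_ _ ey _]].
  by rewrite -[LHS]mulg1 -[in LHS]ey mulgA idemM ey.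
apply/setP=> s; have -> : s \in J.
  by rewrite -[s]mulg1 -e1; case: minJ => [[Jl _] _ _]; apply: Jl.
have := mul_idem_in_max_subgroup rrbgS minJ eJ s; rewrite e1 mulg1.
by move=> sU; apply/max_subgroup_setP; have /max_subgroup_setP := sU; rewrite e1.
Qed.

Lemma to_H_idem : toH e = 1%g.
Proof. by apply: val_inj; rewrite /= idemM. Qed.

(** * The spanning elements [es] - [se] of the bimodule *)

Definition idemJ : minJ_type J := Sub e eJ.
(* The classes of es and se, in this order: minJ_mulr multiplies on the right. *)
Definition left_class (s : S) : XJ := X_class e0 (minJ_mulr minJ s idemJ).
Definition right_class (s : S) : XJ := X_class e0 (minJ_mull minJ s idemJ).

(** That is, [est] = [set] for t outside G. *)
Lemma left_class_mul_nonunit s t : t \notin units_set S ->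
  left_class (s * t)%g = X_class e0 (minJ_mulr minJ t (minJ_mull minJ s idemJ)).
Proof.
move=> tU; have [tJ|tJ] := boolP (t \in J).
  (* For t in J, et = t and ese = se already give est = set in S. *)
  congr X_class; apply: val_inj => /=.
  rewrite -{1}(idem_mul_minimal rrbgS minJ eJ tJ) !mulgA -(mulgA e).
  by rewrite (mul_idem_minimal rrbgS).
rewrite /left_class; apply/X_classP/connect1/andP; split.
  rewrite /= -[(e * _ * e)%g]mulgA (mul_idem_minimal rrbgS).
  by rewrite -!mulgA (mul_idem_minimal rrbgS).
(* Regularity supplies w = t't with tw = t; it is not a unit because t is not, and lies outside J
   because t = tw does. *)
have [t' tt't] := rrbgS.1 t.
apply/existsP; exists (t' * t)%g; rewrite !units_setM negb_and tU orbT /=.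
rewrite -!mulgA [(t * (t' * t))%g]mulgA tt't !eqxx !andbT.
apply: contra tJ => t'tJ; rewrite -tt't -mulgA.
by case: minJ => [[Jl _] _ _]; apply: Jl.
Qed.

Definition class_vec (c : XJ) : 'rV[k]_#|{: XJ}| := delta_mx 0 (enum_rank c).

Definition M_gen (s : S) : 'rV[k]_(\rank (kermx eps)) :=
  in_submod (kermx eps) (class_vec (left_class s) - class_vec (right_class s)).

(** Both classes are sent to se by epsilon, because ese = se; so the difference lies in the
    kernel. *)
Lemma val_M_gen s :
  val_submod (M_gen s) = class_vec (left_class s) - class_vec (right_class s).
Proof.
apply/in_submodK/sub_kermxP; rewrite mulmxBl !delta_fun_mx !X_epsE /=.
by rewrite !to_HM to_H_idem mul1g mulg1 subrr.
Qed.

Lemma val_M_gen_left s t : val_submod (M_gen t *m bimod_left M (toH s)) =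
  class_vec (X_class e0 (minJ_mulr minJ t (minJ_mull minJ s idemJ)))
  - class_vec (right_class (s * t)%g).
Proof.
rewrite /= (val_sub_bimod_left (ker_epsilon_left k rrbgS minJ eJ)) val_M_gen mulmxBl.
rewrite !delta_fun_mx /X_left !(X_mapE _ (smile_mull _ _)).
congr (class_vec (X_class _ _) - class_vec (X_class _ _)); apply: val_inj => /=.
  by rewrite !mulgA -(mulgA s) idemM.
by rewrite -!mulgA (mul_idem_minimal rrbgS).
Qed.

Lemma val_M_gen_right s (g : G) : val_submod (M_gen s *m bimod_right M g) =
  class_vec (left_class (s * val g)%g)
  - class_vec (X_class e0 (minJ_mulr minJ (val g) (minJ_mull minJ s idemJ))).
Proof.
rewrite /= (val_submodJ (ker_epsilon_right k rrbgS minJ eJ)) ?inE // val_M_gen mulmxBl.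
rewrite !delta_fun_mx /X_right !(X_mapE _ (smile_mulr rrbgS _ _)).
by congr (class_vec (X_class _ _) - _); apply: val_inj => /=; rewrite !mulgA.
Qed.

(** [esg] - [sge] splits at [seg]. *)
Lemma M_gen_mul_unit s (g : G) :
  M_gen (s * val g)%g =
    M_gen (val g) *m bimod_left M (toH s) + M_gen s *m bimod_right M g.
Proof.
apply: val_submod_inj; rewrite val_M_gen linearD.
rewrite [X in _ = X + _]val_M_gen_left.
rewrite [X in _ = _ + X]val_M_gen_right.
by rewrite [RHS]addrC addrA subrK.
Qed.

(** The term [est] - [set] vanishes, matching the zero action of t on the module inflated from G. *)
Lemma M_gen_mul_nonunit s t : t \notin units_set S ->
  M_gen (s * t)%g = M_gen t *m bimod_left M (toH s).
Proof.
move=> tU; apply: val_submod_inj; rewrite val_M_gen left_class_mul_nonunit //.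
by rewrite [RHS]val_M_gen_left.
Qed.

Lemma M_gen_idem : M_gen e = 0.
Proof.
apply: val_submod_inj; rewrite val_M_gen linear0; apply/eqP; rewrite subr_eq0.
by apply/eqP; congr (class_vec (X_class _ _)); apply: val_inj.
Qed.

Lemma class_vec_repr c : class_vec c =
  class_vec (left_class (val (X_repr c))).
Proof.
rewrite -[c in LHS]X_reprK; congr (class_vec (X_class _ _)); apply: val_inj => /=.
by rewrite (idem_mul_minimal rrbgS minJ eJ) // (valP (X_repr c)).
Qed.

(** If a combination of classes [x] is in the kernel of epsilon, the same combination of the [xe] is
    0; subtract it and use x = ex. *)
Lemma M_gen_span (y : 'rV[k]_(\rank (kermx eps))) :
  y = \sum_c val_submod y 0 (enum_rank c) *: M_gen (val (X_repr c : minJ_type J)).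
Proof.
apply: val_submod_inj; set v := val_submod y.
have vE : v = \sum_c v 0 (enum_rank c) *: class_vec c.
  rewrite {1}[v]row_sum_delta (reindex (@enum_rank XJ)) //=.
  exact/onW_bij/enum_rank_bij.
have v0 : \sum_c v 0 (enum_rank c) *: class_vec (right_class (val (X_repr c))) = 0.
  (* The map [x] |-> [xe] factors through epsilon, via h |-> [h]. *)
  transitivity (v *m eps *m fun_mx k (fun h : H => right_class (val h))); last first.
    by have /sub_kermxP-> := val_submodP y; rewrite mul0mx.
  rewrite [in RHS]vE !mulmx_suml; apply: eq_bigr => c _.
  rewrite -!scalemxAl; congr (_ *: _).
  rewrite (delta_fun_mx _ (X_eps rrbgS minJ eJ)) (delta_fun_mx _ (fun h : H => _)).
  congr (class_vec (X_class _ _)); apply: val_inj => /=.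
  by rewrite -[RHS]mulgA idemM.
rewrite linear_sum /= {1}vE -[LHS]subr0 -[X in _ - X]v0 -sumrB.
by apply: eq_bigr => c _; rewrite [RHS]linearZ /= val_M_gen -class_vec_repr scalerBr.
Qed.

Lemma M_gen_ext (W : lmodType k) (f g : {linear 'rV[k]_(\rank (kermx eps)) -> W}) :
  (forall s, f (M_gen s) = g (M_gen s)) -> f =1 g.
Proof.
move=> fg y; rewrite (M_gen_span y) !linear_sum; apply: eq_bigr => c _.
by rewrite !linearZ fg.
Qed.

(** * Cocycles as homomorphisms from the tensor product *)

Section ExtHom.
Variables (m n : nat) (rU : mx_representation k [set: H] m).
Variable rV : mx_representation k [set: G] n.
Local Notation tU := (tilde_minimal rrbgS minJ eJ rU).
Local Notation tV := (tilde_units rV).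
Local Notation UM := (tensor_over rU M).
Local Notation cochain := {ffun S -> 'M[k]_(m, n)}.

Lemma tilde_unitsE (g : G) : tV (val g) = rV g.
Proof.
by rewrite /= (tilde_units_mxT rV (valP g)); congr (rV _); apply: val_inj.
Qed.

Lemma tilde_units_idem : tV e = 0.
Proof. exact/tilde_units_mxF/idem_minimal_nonunit. Qed.

Lemma tilde_minimal_idem : tU e = 1%:M.
Proof. by rewrite /= to_H_idem repr_mx1. Qed.

(** [e] acts as 1 on the source and as 0 on the target. *)
Lemma Hom_tilde_eq0 : \dim (Hom_space tU tV) = 0%N.
Proof.
apply/eqP; rewrite dimv_eq0 -subv0; apply/subvP=> f /Hom_spaceP/(_ e).
by rewrite tilde_units_idem tilde_minimal_idem mul1mx mulmx0 memv0 => ->.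
Qed.

Definition hom_cochain (f : 'M[k]_(_, n)) : cochain :=
  [ffun s => tensor_mx rU M (M_gen s) *m f].

Fact hom_cochain_linear : linear hom_cochain.
Proof.
by move=> a f g; apply/ffunP=> s; rewrite !ffunE mulmxDr -scalemxAr.
Qed.
HB.instance Definition _ := GRing.isLinear.Build k 'M[k]_(_, n) cochain _
  hom_cochain hom_cochain_linear.

Lemma tensor_gen_inj p (f g : 'M[k]_(_, p)) :
    (forall s, tensor_mx rU M (M_gen s) *m f = tensor_mx rU M (M_gen s) *m g) ->
  f = g.
Proof.
move=> fg; apply: (tensor_mx_inj (rU := rU) (B := M)) => y.
exact: (M_gen_ext (f := mulmxr f \o tensor_mx rU M) (g := mulmxr g \o tensor_mx rU M)).
Qed.

(** The two product rules for [M_gen], for t a unit or not, become the cocycle identity under the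
    balanced, equivariant map [f]. *)
Lemma hom_cochain_cocycle f : f \in group_hom_space UM rV ->
  mx_cocycle tU tV (hom_cochain f).
Proof.
move=> /group_hom_spaceP fH s t; rewrite !ffunE.
have [tG|tG] := boolP (t \in units_set S); last first.
  rewrite M_gen_mul_nonunit // /= (tilde_units_mxF rV tG) mulmx0 addr0.
  by rewrite -tensor_mx_left mulmxA.
rewrite -[t](SubK (G : subType _) tG) tilde_unitsE M_gen_mul_unit.
rewrite tensor_mxD mulmxDl; congr (_ + _).
  by rewrite -(tensor_mx_left rU M) -mulmxA.
by rewrite -(tensor_mx_right rU M) -[LHS]mulmxA fH [LHS]mulmxA.
Qed.

Lemma cocycle_nonunit c s t : mx_cocycle tU tV c -> t \notin units_set S ->
  c (s * t)%g = tU s *m c t.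
Proof.
by move=> cZ tG; rewrite cZ [tV t](tilde_units_mxF rV tG) mulmx0 addr0.
Qed.

(** When xw = x with w outside G, c(x) = x c(w), and x acts on U through xe, which related elements
    share. *)
Lemma cocycle_class c (x y : minJ_type J) : mx_cocycle tU tV c ->
  X_class e0 x = X_class e0 y -> c (val x) = c (val y).
Proof.
move=> cZ /X_classP/connectP[p]; elim: p x => [x _ -> //|z p IH x /=].
case/andP=> /andP[/eqP xze /existsP[w /and4P[wG _ /eqP xw /eqP zw]]] zp yp.
rewrite -(IH z zp yp) -xw -zw !(cocycle_nonunit _ cZ wG).
by congr (rU _ *m _); apply: val_inj.
Qed.

Lemma cocycle_lift c : mx_cocycle tU tV c -> c e = 0 ->
  exists2 f, f \in group_hom_space UM rV & hom_cochain f = finfun c.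
Proof.
move=> cZ ce0.
have c_left s : c (e * s)%g = c s.
  by rewrite cZ tilde_minimal_idem mul1mx ce0 mul0mx addr0.
have c_right s : c (s * e)%g = 0.
  by rewrite cocycle_nonunit ?ce0 ?mulmx0 ?idem_minimal_nonunit.
(* The linear extension of [c] to kX; [D] is its restriction to the kernel of epsilon. *)
pose E (v : 'rV[k]_#|{: XJ}|) : 'M[k]_(m, n) :=
  \sum_q v 0 (enum_rank q) *: c (val (X_repr q)).
have E_lin : linear E.
  move=> a u v; rewrite /E scaler_sumr -big_split; apply: eq_bigr => q _ /=.
  by rewrite !mxE scalerDl scalerA.
pose El : {linear _ -> _} := HB.pack E (GRing.isLinear.Build k _ _ _ E E_lin).
have EE x : El (class_vec (X_class e0 x)) = c (val x).
  rewrite /= /E (bigD1 (X_class e0 x)) //= mxE !eqxx scale1r big1 ?addr0.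
    by apply: cocycle_class => //; rewrite X_reprK.
  by move=> q qx; rewrite mxE (inj_eq enum_rank_inj) (negPf qx) andbF scale0r.
pose D y := El (val_submod (U := kermx eps) y).
have D_lin : linear D by move=> a u v; rewrite /D !linearP.
pose Dl : {linear 'rV_(\rank (kermx eps)) -> 'M_(m, n)} :=
  HB.pack D (GRing.isLinear.Build k _ _ _ D D_lin).
have Dgen s : D (M_gen s) = c s.
  by rewrite /D val_M_gen linearB !EE /= c_left c_right subr0.
(* The value is c(set) - c(ste), where c(ste) = 0 and c(set) = s c(t) because c(se) = 0. *)
have Dleft_gen s t : D (M_gen t *m bimod_left M (toH s)) = rU (toH s) *m c t.
  rewrite /D val_M_gen_left linearB !EE /= c_right subr0.
  by rewrite cZ c_right mul0mx addr0 /= to_HM to_H_idem mulg1.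
have Dleft h y : rU h *m Dl y = Dl (y *m bimod_left M h).
  apply: (M_gen_ext (f := mulmx (rU h) \o Dl) (g := Dl \o mulmxr (bimod_left M h))).
  by move=> s /=; rewrite Dgen -[in RHS](to_H_val rrbgS minJ eJ h) Dleft_gen to_H_val.
have [f fE] := tensor_mx_lift Dleft.
exists f; last by apply/ffunP=> s; rewrite !ffunE fE /= Dgen.
(* On generators, equivariance reads c(esg) - c(seg) = c(sg) - s c(g) = c(s) g. *)
apply/group_hom_spaceP=> g; apply: tensor_gen_inj => s.
rewrite [LHS]mulmxA [RHS]mulmxA tensor_mx_right !fE /= Dgen.
rewrite /D val_M_gen_right linearB !EE /= c_left.
rewrite cZ tilde_unitsE [c (_ * _ * _)%g]cZ c_right mul0mx addr0 /= to_HM.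
by rewrite to_H_idem mulg1 addrAC subrr add0r.
Qed.

(** Evaluation at [e] maps the cocycles onto Hom_k(U, V); its kernel is the injective image of
    [hom_cochain] on Hom_kG(U (x) M, V). *)
Lemma dim_cocycle_tilde : \dim (cocycle_space tU tV) =
  (\dim (group_hom_space UM rV) + m * n)%N.
Proof.
pose ev (c : cochain) := c e.
have ev_lin : linear ev by move=> a c d; rewrite /ev !ffunE.
pose evl : {linear cochain -> _} := HB.pack ev (GRing.isLinear.Build k _ _ _ ev ev_lin).
have -> : \dim (group_hom_space UM rV) =
    \dim (linfun hom_cochain @: group_hom_space UM rV).
  rewrite limg_dim_eq //; apply/eqP; rewrite -subv0; apply/subvP=> f.
  rewrite memv_cap memv_ker lfunE /= memv0 => /andP[_ /eqP/ffunP f0].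
  apply/eqP/tensor_gen_inj => s; rewrite mulmx0; have := f0 s.
  by rewrite !ffunE.
have -> : (m * n = \dim {: 'M[k]_(m, n)})%N by rewrite dimvf dim_matrix.
apply: (@dimv_surj _ _ _ evl) => [c|a _|c].
- by rewrite memvf.
(* The principal cocycle of [a] takes the value [a] at [e]. *)
- exists [ffun s => tU s *m a - a *m tV s].
    apply/cocycle_spaceP=> s t; rewrite !ffunE !monoid_reprM mulmxBr mulmxBl.
    by rewrite !mulmxA addrA subrK.
  apply: etrans (ffunE _ _) _; rewrite tilde_minimal_idem tilde_units_idem.
  by rewrite mul1mx mulmx0 subr0.
split=> [/memv_imgP[f fH ->]|[/cocycle_spaceP cZ ce0]].
  rewrite lfunE; split; first exact/cocycle_spaceP/hom_cochain_cocycle.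
  by rewrite /= /ev ffunE M_gen_idem linear0 mul0mx.
have [f fH fc] := cocycle_lift cZ ce0.
apply/memv_imgP; exists f => //; rewrite lfunE /= fc.
by apply/ffunP=> s; rewrite ffunE.
Qed.

End ExtHom.
End MinimalExt.

(** The group of units is the maximal subgroup at 1; this is the form Maschke's theorem takes for
    kG. *)
Lemma pchar'_units (k : fieldType) (S : finMonoidType) :
    (forall (f : idempotent_of S) (p : nat),
       p \in [pchar k] -> ~~ (p %| #|{: max_subgroup f}|)%N) ->
  ([pchar k]^'.-group [set: units_group S])%g.
Proof.
move=> charS; apply/pgroupP=> p p_pr; rewrite cardsT => pG.
by apply: contraL pG => /charS; apply.
Qed.

Theorem theorem5p15 (k : closedFieldType) (S : finMonoidType)
    (rrbgS : right_regular_band_of_groups S)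
    (charS : forall (f : idempotent_of S) (p : nat),
       p \in [pchar k] -> ~~ (p %| #|{: max_subgroup f}|)%N)
    (J : {set S}) (minJ : minimal_ideal J) (GneqJ : units_set S != J)
    (e : idempotent_of S) (eJ : idem_val e \in J)
    (m n : nat)
    (rU : mx_representation k [set: max_subgroup e] m)
    (rV : mx_representation k [set: units_group S] n)
    (irrU : mx_irreducible rU) (irrV : mx_irreducible rV)
    (P : projective_resolution (tilde_minimal rrbgS minJ eJ rU))
    (Ws : seq 'M[k]_(_))
    (compWs : mx_composition_series
       (tensor_over rU (bimoduleM k rrbgS minJ eJ)) Ws)
    (lastWs : (last 0 Ws :=: 1%:M)%MS) :
  dim_Ext P (tilde_units rV) 1 = multiplicity rV compWs.
Proof.
(* Both sides are dim Hom_kG(U (x) M, V): the summand [m * n] occurs in both dimension formulas and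
   cancels. *)
rewrite -(dim_hom_multiplicity (pchar'_units charS) irrV compWs lastWs).
have := dim_Ext1E (tilde_units rV) P.
by rewrite dim_cocycle_tilde // Hom_tilde_eq0 // addn0 => /addIn.
Qed.
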